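(* Let $(\boldsymbol\mu_i,\gamma_i,\Sigma_i,\Psi_i)_{i\in[n]}$ be a network setting. Then any stable point $(W,P)$ is Higher-Order Nash Stable.
   Context: $[n]=\{1,\dots,n\}$; $\mathbf e_1,\dots,\mathbf e_n$ is the standard basis of $\mathbb R^n$. A network setting $(\boldsymbol\mu_i,\gamma_i,\Sigma_i,\Psi_i)_{i\in[n]}$ consists, for each agent $i\in[n]$, of a vector $\boldsymbol\mu_i\in\mathbb R^n$, a scalar $\gamma_i>0$, a symmetric positive definite matrix $\Sigma_i\in\mathbb R^{n\times n}$, and a constraint matrix $\Psi_i$ encoding an ordered set $J_i\subseteq[n]$ of agents with whom $i$ may form an edge (where $k\in J_i$ if and only if $i\in J_k$; $i\in J_i$ means the self-loop is permitted): $\Psi_i\in\{0,1\}^{|J_i|\times n}$ is obtained from $I_n$ by deleting the rows not indexed by $J_i$. A pair $(W,P)$ of real $n\times n$ matrices is feasible if $W=W^T$, $P=-P^T$, and $W_{ik}=P_{ik}=0$ whenever $k\notin J_i$. With $\mathbf w_i$ the $i$-th column of $W$, agent $i$'s utility is $g_i(W,P)=\mathbf w_i^T(\boldsymbol\mu_i-P\mathbf e_i)-\gamma_i\,\mathbf w_i^T\Sigma_i\mathbf w_i$. A feasible $(W,P)$ is a stable point if for every $i\in[n]$, $g_i(W,P)=\max g_i(W',P)$, the maximum being over all $W'$ such that $(W',P)$ is feasible. Agent action. At a feasible point $(W,P)$, an action by agent $i$ is an ordered set $(w'_{ij},p'_{ij})_{j\in J_i}$, representing proposed changes to $i$'s existing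 contracts (sizes $w'_{ij}$ and prices $p'_{ij}$). Each agent $j\in J_i$ responds as follows: (1) if the new $(w'_{ij},p'_{ij})$ raises $j$'s utility, then $j$ agrees to the revised contract and price; (2) otherwise, $i$ must either keep the existing contract (size $W_{ij}$ and price $P_{ij}$) or cancel it (setting $w_{ij}=p_{ij}=0$); it is assumed that $i$ cancels the contract if and only if this strictly increases $i$'s utility. The shifted feasible point $(W',P')$ obtained after these responses is called the resulting network. A feasible $(W,P)$ is Higher-Order Nash Stable if: 1. (Nash equilibrium) no agent $i$ has an action such that the resulting network $(W',P')$ is strictly better for $i$ (i.e. gives $i$ strictly higher utility than $(W,P)$); and 2. (Cartel robustness) for any proper subset $S\subset[n]$, there is no feasible point $(W',P')$ that differs from $(W,P)$ only at indices $\{i,j\}$ with $i\in S$, $j\in S$ such that all agents in $S$ have higher utility under $(W',P')$ than under $(W,P)$. *)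

(* Defs.v *)
From mathcomp Require Import all_boot all_order all_algebra.
From mathcomp Require Import reals.

Set Implicit Arguments.
Unset Strict Implicit.
Unset Printing Implicit Defensive.

Import Order.TTheory GRing.Theory Num.Theory.
Local Open Scope ring_scope.

Definition posdef_mx (R : realType) (n : nat) (A : 'M[R]_n) : Prop :=
  A^T = A /\ forall x : 'cV[R]_n, x != 0 -> 0 < (x^T *m A *m x) 0 0.

(* [enum_val] lists [J i] increasingly, so [rowsub enum_val 1%:M] is the
   identity matrix with the rows outside [J i] deleted. *)
Record network_setting (R : realType) (n : nat) := NetworkSetting {
  mu : 'I_n -> 'cV[R]_n;
  gamma : 'I_n -> R;
  Sigma : 'I_n -> 'M[R]_n;
  J : 'I_n -> {set 'I_n};
  Psi : forall i, 'M[R]_(#|J i|, n);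
  gamma_gt0 : forall i, 0 < gamma i;
  Sigma_posdef : forall i, posdef_mx (Sigma i);
  J_sym : forall i k, (k \in J i) = (i \in J k);
  PsiE : forall i, Psi i = rowsub enum_val 1%:M
}.

(* A pair (W, P) of contract sizes and prices. *)
Definition network (R : realType) (n : nat) : Type := ('M[R]_n * 'M[R]_n)%type.

Section Networks.

Variables (R : realType) (n : nat) (s : network_setting R n).
Implicit Types (N : network R n) (i j k l : 'I_n).

Definition feasible N : Prop :=
  [/\ N.1 = N.1^T, N.2 = - N.2^T &
      forall i k, k \notin J s i -> N.1 i k = 0 /\ N.2 i k = 0].

Definition utility i N : R :=
  let w := col i N.1 in
  (w^T *m (mu s i - N.2 *m delta_mx i 0)) 0 0
    - gamma s i * (w^T *m Sigma s i *m w) 0 0.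

Definition stable_point N : Prop :=
  feasible N /\
  forall i (W' : 'M[R]_n), feasible (W', N.2) ->
    utility i (W', N.2) <= utility i N.

(* Give the contract between [i] and [j] size [c.1] and price [c.2] as seen from
   [i] (entry (i, j)); symmetry of W and antisymmetry of P fix entry (j, i). *)
Definition set_contract i j (c : R * R) N : network R n :=
  (\matrix_(k, l) (if ((k, l) == (i, j)) || ((k, l) == (j, i)) then c.1
                   else N.1 k l),
   \matrix_(k, l) (if (k, l) == (i, j) then c.2
                   else if (k, l) == (j, i) then - c.2
                   else N.2 k l)).

(* [a j] is the pair (w'_ij, p'_ij); only the values at [j \in J s i] matter.
   Antisymmetry of P leaves 0 as the only possible price of a self-loop. *)
Definition is_action i (a : 'I_n -> R * R) : Prop := i \in J s i -> (a i).2 = 0.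

(* [N'] results from the action [a] of [i] at [N]. Each contract is decided by
   comparing its alternatives with all other contracts as they are in [N']. For
   [j != i] the utility of [j] does not involve the other contracts of [i], so
   the test for the agreement of [j] is the same as at [N]; the other contracts
   only matter for the decisions of [i] itself (cancellations and self-loop),
   which therefore have to be mutually consistent. *)
Definition resulting_network i (a : 'I_n -> R * R) N N' : Prop :=
  [/\ feasible N',
      forall k l, k != i -> l != i -> N'.1 k l = N.1 k l /\ N'.2 k l = N.2 k l &
      forall j, j \in J s i ->
        let revised := set_contract i j (a j) N' in
        let kept := set_contract i j (N.1 i j, N.2 i j) N' in
        let cancelled := set_contract i j (0, 0) N' in
        N' = if utility j kept < utility j revised then revised
             else if utility i kept < utility i cancelled then cancelled
             else kept].

Definition nash_equilibrium N : Prop :=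
  forall i (a : 'I_n -> R * R), is_action i a ->
    ~ exists N', resulting_network i a N N' /\ utility i N < utility i N'.

(* The empty coalition is excluded: for it the condition would fail at every
   feasible [N] (take [N' = N]). *)
Definition cartel_robust N : Prop :=
  forall S : {set 'I_n}, S != set0 -> S \proper [set: 'I_n] ->
    ~ exists N',
        [/\ feasible N',
            forall k l, N'.1 k l <> N.1 k l \/ N'.2 k l <> N.2 k l ->
              k \in S /\ l \in S &
            forall i, i \in S -> utility i N < utility i N'].

Definition higher_order_nash_stable N : Prop :=
  [/\ feasible N, nash_equilibrium N & cartel_robust N].

End Networks.

(* Main.v *)
(** The price [P j i] is a transfer between [i] and [j], so replacing [P] by
    [P'] at fixed sizes [W'] changes the utility of [i] by
    [\sum_j W' j i * (P j i - P' j i)], and these terms are antisymmetric in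
    [(i, j)]. At a stable point no agent gains from a change of sizes at the
    prices [P], so an agent who gains must gain from the transfers. Over a
    coalition the transfers add up to zero; and a counterparty who agrees to a
    revised contract gains on the transfer that the proposer then loses. *)
Require Import Defs.
From mathcomp Require Import all_boot all_order all_algebra.
From mathcomp Require Import reals.

Set Implicit Arguments.
Unset Strict Implicit.
Unset Printing Implicit Defensive.

Import Order.TTheory GRing.Theory Num.Theory.
Local Open Scope ring_scope.

Section StablePoints.

Variables (R : realType) (n : nat) (s : network_setting R n).
Implicit Types (N : network R n) (W P : 'M[R]_n) (i j k l : 'I_n).

Definition transfer N N' i j : R := N'.1 j i * (N.2 j i - N'.2 j i).

Lemma eq_utility i N N' :
  col i N.1 = col i N'.1 -> col i N.2 = col i N'.2 ->
  utility s i N = utility s i N'.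
Proof. by rewrite /utility -!colE => -> ->. Qed.

Lemma utility_price i N N' :
  utility s i N' = utility s i (N'.1, N.2) + \sum_j transfer N N' i j.
Proof.
rewrite /utility /= addrAC; congr (_ - _).
rewrite -!colE !mxE -big_split /=; apply: eq_bigr => j _.
by rewrite !mxE /transfer -mulrDr addrA subrK.
Qed.

Lemma feasible_sym N i j : feasible s N -> N.1 i j = N.1 j i.
Proof. by case=> symW _ _; rewrite [in LHS]symW mxE. Qed.

Lemma feasible_antisym N i j : feasible s N -> N.2 i j = - N.2 j i.
Proof. by case=> _ antiP _; rewrite [in LHS]antiP !mxE. Qed.

Lemma feasible_diag N i : feasible s N -> N.2 i i = 0.
Proof.
by move=> fN; apply/eqP; rewrite -eqNr -feasible_antisym.
Qed.

Lemma transfer_antisym N N' i j : feasible s N -> feasible s N' ->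
  transfer N N' j i = - transfer N N' i j.
Proof.
move=> fN fN'; rewrite /transfer (feasible_sym i j fN').
by rewrite (feasible_antisym i j fN) (feasible_antisym i j fN') -opprD mulrN.
Qed.

(** The sizes of [N'] with the prices of [N] form a feasible point, which stability bounds; passing
    to the prices of [N'] then adds exactly the transfers. *)
Lemma stable_utility_le N N' i : stable_point s N -> feasible s N' ->
  utility s i N' <= utility s i N + \sum_j transfer N N' i j.
Proof.
case=> -[_ antiP suppP] stN [symW _ suppW].
rewrite (utility_price i N) lerD2r; apply: stN; split=> //= k l kl.
by split; [case: (suppW k l kl) | case: (suppP k l kl)].
Qed.

(** A cancelled contract has size 0 and a kept one its old price, so neither gives a transfer. If
    [j] agrees to a revision, [j] is strictly better off, which by [stable_utility_le] needs a
    positive transfer to [j]. *)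
Lemma resulting_transfer_le0 N N' i a j :
  stable_point s N -> resulting_network s i a N N' -> transfer N N' i j <= 0.
Proof.
move=> stN [fN' same dec]; have fN := stN.1.
have [ji|ji] := boolP (j \in J s i); last first.
  have [_ _ /(_ j i)] := fN'; rewrite J_sym ji => /(_ isT)[W0 _].
  by rewrite /transfer W0 mul0r.
have [->|jNi] := eqVneq j i.
  by rewrite /transfer !(feasible_diag _ fN, feasible_diag _ fN') subrr mulr0.
(* Column [j] of [N'] can differ from that of [N] only in row [i], which keeping the contract
   restores. *)
have keptE : utility s j (set_contract i j (N.1 i j, N.2 i j) N')
    = utility s j N.
  apply: eq_utility; apply/matrixP => k z; rewrite !mxE !xpair_eqE eqxx ?andbT;
  by rewrite (negPf jNi) andbF ?orbF; have [->|ki] := eqVneq k i => //=;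
     case: (same k j ki jNi).
have /= := dec j ji; rewrite keptE.
case: ifP => [agree N'E|_].
  rewrite -oppr_ge0 -transfer_antisym // ltW //.
  have -> : transfer N N' j i = \sum_k transfer N N' j k.
    rewrite (bigD1 i) //= big1 ?addr0 // => k ki.
    by rewrite /transfer (same k j ki jNi).2 subrr mulr0.
  rewrite -(ltrD2l (utility s j N)) addr0.
  by apply: lt_le_trans (stable_utility_le j stN fN'); rewrite N'E.
case: ifP => _ N'E.
  by rewrite /transfer N'E /= !mxE eqxx orbT mul0r.
rewrite /transfer; suff -> : N'.2 j i = N.2 j i by rewrite subrr mulr0.
by rewrite N'E /= mxE !xpair_eqE !eqxx (negPf jNi) /= -feasible_antisym.
Qed.

Lemma stable_nash_equilibrium N : stable_point s N -> nash_equilibrium s N.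
Proof.
move=> stN i a _ [N' [resN']]; apply/negP; rewrite -leNgt.
have [fN' _ _] := resN'; apply: le_trans (stable_utility_le i stN fN') _.
by rewrite gerDl sumr_le0 // => j _; apply: resulting_transfer_le0 resN'.
Qed.

Lemma stable_cartel_robust N : stable_point s N -> cartel_robust s N.
Proof.
move=> stN S /set0Pn[i0 i0S] _ [N' [fN' onS gain]].
(* By [onS], prices with agents outside [S] do not change. *)
have transferS i : \sum_j transfer N N' i j = \sum_(j in S) transfer N N' i j.
  rewrite [RHS]big_mkcond; apply: eq_bigr => j _; case: ifPn => // jS.
  have [PE|/eqP PE] := eqVneq (N'.2 j i) (N.2 j i).
    by rewrite /transfer PE subrr mulr0.
  by have [] := onS j i (or_intror PE); rewrite (negPf jS).
have transfer0 : \sum_(i in S) \sum_(j in S) transfer N N' i j = 0.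
  (* Exchanging the two indices turns the double sum into its own negative. *)
  apply/eqP; rewrite -eqNr {1}exchange_big /= -sumrN.
  apply/eqP/eq_bigr => i _; rewrite -sumrN; apply: eq_bigr => j _.
  by rewrite (transfer_antisym i j stN.1 fN') opprK.
have : \sum_(i in S) utility s i N' <= \sum_(i in S) utility s i N.
  rewrite -[leRHS]addr0 -[X in _ + X]transfer0 -big_split /=; apply: ler_sum => i _.
  by rewrite -transferS stable_utility_le.
apply/negP; rewrite -ltNge; apply: ltr_sum => //.
(* Strict inequalities add up to a strict one only over a nonempty index set, hence [i0]. *)
by apply/hasP; exists i0; rewrite ?mem_index_enum.
Qed.

End StablePoints.

Theorem theorem3 (R : realType) (n : nat) (s : network_setting R n)
  (W P : 'M[R]_n) :
  stable_point s (W, P) -> higher_order_nash_stable s (W, P).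
Proof.
move=> stWP; split; first exact: stWP.1.
  exact: stable_nash_equilibrium.
exact: stable_cartel_robust.
Qed.
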